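(* Let $\Lambda_{TT}=\{(F(x),\Lambda_x,v(x))\}_{x\in X}$ be a continuous $(T,T)$-controlled $g$-fusion Bessel family for $H$ with bound $B$ and $\Gamma_{UU}=\{(G(x),\Gamma_x,w(x))\}_{x\in X}$ a continuous $(U,U)$-controlled $g$-fusion Bessel family for $H$ with bound $D$. Let $m\in L^\infty(X,\mu)$. Then the operator $M_{m,\Lambda T,\Gamma U}:H\to H$ defined by $$\langle M_{m,\Lambda T,\Gamma U}f,g\rangle=\int_X m(x)v(x)w(x)\,\langle T P_{F(x)}\Lambda_x^*\Gamma_xP_{G(x)}Uf,\,g\rangle\,d\mu_x,\qquad f,g\in H,$$ is a well-defined and bounded operator.
   Context: $H$ is a separable Hilbert space, $\mathbb H$ is the collection of all closed subspaces of $H$, and $(X,\mu)$ is a measure space with positive measure $\mu$; $d\mu_x$ denotes integration with respect to $\mu$ in the variable $x$. $P_M$ is the orthogonal projection of $H$ onto a closed subspace $M$ (when followed by an operator defined on $M$ it is regarded as a map $H\to M$; its adjoint is then the inclusion $M\to H$). An operator is positive if it is self-adjoint and $\langle Sf,f\rangle\ge 0$ for all $f$; $\mathcal{GB}^+(H)$ is the set of positive bounded operators on $H$ with bounded inverse. Here $T,U\in\mathcal{GB}^+(H)$; $F,G:X\to\mathbb H$ are weakly measurable (for each $f\in H$, $x\mapsto P_{F(x)}f$ and $x\mapsto P_{G(x)}f$ are measurable); $v,w:X\to\mathbb R^+$ are measurable; $\{K_x\}_{x\in X}$ are Hilbert spaces; and $\Lambda_x:F(x)\to K_x$, $\Gamma_x:G(x)\to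 K_x$ are bounded linear for each $x\in X$. $\Lambda_{TT}$ is a continuous $(T,T)$-controlled $g$-fusion Bessel family with bound $B<\infty$ if $\int_X v^2(x)\langle\Lambda_xP_{F(x)}Tf,\Lambda_xP_{F(x)}Tf\rangle\,d\mu_x\le B\|f\|^2$ for all $f\in H$; $\Gamma_{UU}$ is a continuous $(U,U)$-controlled $g$-fusion Bessel family with bound $D<\infty$ if $\int_X w^2(x)\langle\Gamma_xP_{G(x)}Uf,\Gamma_xP_{G(x)}Uf\rangle\,d\mu_x\le D\|f\|^2$ for all $f\in H$. The integrands occurring in these formulas are understood to be measurable.
   Formalization: The integrand defining M is assumed measurable for all f, g; this does not follow from measurability of the two Bessel integrands (take scalar Γ_x = ±1 with non-measurable sign), and without it the defining integral is undefined. *)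

(* Defs.v *)
From HB Require Import structures.
From mathcomp Require Import all_boot all_order all_algebra.
From mathcomp Require Import complex.
From mathcomp Require Import all_classical all_reals all_analysis.

Set Implicit Arguments.
Unset Strict Implicit.
Unset Printing Implicit Defensive.

Import Order.TTheory GRing.Theory Num.Theory.
Import numFieldNormedType.Exports.

Local Open Scope classical_set_scope.
Local Open Scope complex_scope.
Local Open Scope ring_scope.

(* Complex Hilbert spaces; the inner product is linear in its first argument.
   The norm of a normed module over R[i] takes its values in R[i]. *)
HB.mixin Record NormedModule_hasInner (R : realType) H
    & NormedModule R[i] H := {
  inner : {dot H for (@Num.conj R[i])} ;
  inner_norm : forall x : H, inner x x = `|x| ^+ 2
}.

#[short(type="hilbertType")]
HB.structure Definition Hilbert (R : realType) :=
  {H of CompleteNormedModule R[i] H & NormedModule_hasInner R H}.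

Definition separable (V : topologicalType) :=
  exists A : set V, countable A /\ dense A.

Record closedSubspace (R : realType) (H : hilbertType R) := ClosedSubspace {
  subspace_pred : {pred H} ;
  subspace_submod : submod_closed subspace_pred ;
  subspace_closed : closed [set x | x \in subspace_pred]
}.

HB.instance Definition _ (R : realType) (H : hilbertType R)
    (M : closedSubspace H) :=
  GRing.isSubmodClosed.Build R[i] H (subspace_pred M) (subspace_submod M).

Record subspace_type (R : realType) (H : hilbertType R) (M : closedSubspace H) :=
  SubspaceElt { subspace_val : H ; subspace_valP : subspace_val \in subspace_pred M }.

Coercion subspace_type : closedSubspace >-> Sortclass.

Section ClosedSubspaceHilbert.
Context (R : realType) (H : hilbertType R) (M : closedSubspace H).

HB.instance Definition _ := [isSub for @subspace_val R H M].
HB.instance Definition _ := [Choice of M by <:].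
HB.instance Definition _ := [SubChoice_isSubLmodule of M by <:].

Definition subspace_norm (x : M) : R[i] := `|val x|.

Let normD (x y : M) : subspace_norm (x + y) <= subspace_norm x + subspace_norm y.
Proof. by rewrite /subspace_norm raddfD ler_normD. Qed.

Let normZ (l : R[i]) (x : M) : subspace_norm (l *: x) = `|l| * subspace_norm x.
Proof. by rewrite /subspace_norm linearZ normrZ. Qed.

Let norm_eq0 (x : M) : subspace_norm x = 0 -> x = 0.
Proof. by move=> /normr0_eq0 x0; apply: val_inj; rewrite x0 raddf0. Qed.

HB.instance Definition _ := Lmodule_isNormed.Build R[i] M normD normZ norm_eq0.

Lemma subspace_normE (x : M) : `|x| = `|val x|.
Proof. by []. Qed.

Let subspace_complete (F : set_system M) :
  ProperFilter F -> cauchy F -> cvg F.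
Proof.
move=> FF /cauchy_ballP Fc.
have Gc : cauchy (val @ F : set_system H).
  apply/cauchy_ballP => e e0.
  case: (Fc e e0) => -[A B] /= [FA FB] AB.
  exists (val @` A, val @` B).
    split; rewrite /nbhs/=.
      by apply: filterS FA => x Ax; exists x.
    by apply: filterS FB => x Bx; exists x.
  move=> [_ _] /= [[x Ax <-] [y By <-]].
  by have := AB (x, y) (conj Ax By); rewrite -!ball_normE /ball_/= subspace_normE raddfB.
have : cvg (val @ F : set_system H) by exact: cauchy_cvg Gc.
move=> /cvg_ex[l Gl].
have lM : l \in subspace_pred M.
  have valM : \forall x \near F, [set y | y \in subspace_pred M] (val x).
    by near=> x; exact: (subspace_valP x).
  exact: closed_cvg (@subspace_closed _ _ M) valM l Gl.
apply/cvg_ex; exists (SubspaceElt lM).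
apply/cvgrPdist_lt => e e0.
move/cvgrPdist_lt: Gl => /(_ e e0).
by apply: filterS => x; rewrite subspace_normE raddfB.
Unshelve. all: by end_near. Qed.

HB.instance Definition _ := Uniform_isComplete.Build M subspace_complete.

Definition subspace_inner (x y : M) : R[i] := inner (val x) (val y).

Let sinner_addl y : zmod_morphism (subspace_inner ^~ y).
Proof. by move=> a b; rewrite /subspace_inner raddfB linearBl. Qed.
Let sinner_addr x : zmod_morphism (subspace_inner x).
Proof. by move=> a b; rewrite /subspace_inner !raddfB. Qed.
Let sinner_scalel y : scalable_for *%R (subspace_inner ^~ y).
Proof. by move=> a x; rewrite /subspace_inner linearZ; exact: linearl_subproof. Qed.
Let sinner_scaler x : scalable_for (@Num.conj R[i] \; *%R) (subspace_inner x).
Proof. by move=> a y; rewrite /subspace_inner GRing.valZ; exact: linearr_subproof. Qed.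
HB.instance Definition _ := @isBilinear.Build R[i] M M R[i] *%R
  (@Num.conj R[i] \; *%R) subspace_inner
  sinner_addl sinner_addr sinner_scalel sinner_scaler.

Let sinner_herm (x y : M) :
  subspace_inner x y = (-1) ^+ false * Num.conj (subspace_inner y x).
Proof. by rewrite /subspace_inner; exact: hermitian_subproof. Qed.
HB.instance Definition _ :=
  @isHermitianSesquilinear.Build R[i] M false (@Num.conj R[i]) subspace_inner sinner_herm.

Let sinner_gt0 (x : M) : x != 0 -> 0 < subspace_inner x x.
Proof. by move=> x0; rewrite /subspace_inner inner_norm exprn_gt0// normr_gt0. Qed.
HB.instance Definition _ := @isDotProduct.Build R[i] M subspace_inner sinner_gt0.

Let sinner_norm (x : M) : subspace_inner x x = `|x| ^+ 2.
Proof. by rewrite /subspace_inner inner_norm. Qed.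
HB.instance Definition _ := NormedModule_hasInner.Build R M sinner_norm.

Lemma subspace_innerE (x y : M) : inner x y = inner (val x) (val y).
Proof. by []. Qed.

End ClosedSubspaceHilbert.

Section Operators.
Context (R : realType).
Implicit Types H K : hilbertType R.

Definition bounded_op H K (A : H -> K) :=
  exists C : R, forall f : H, `|A f| <= C%:C * `|f|.

(* The value of [xget] is the unique element of the given set, which exists by
   the projection theorem (resp., for bounded linear [A], by Riesz). *)
Definition orthproj H (M : closedSubspace H) (f : H) : M :=
  xget 0 [set p : M | forall q : M, inner (f - val p) (val q) = 0].

Definition adjoint H K (A : H -> K) (k : K) : H :=
  xget 0 [set h : H | forall f : H, inner (A f) k = inner f h].

Definition positive_op H (T : H -> H) :=
  adjoint T =1 T /\ forall f : H, 0 <= inner (T f) f.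

Definition GBpos H (T : {linear H -> H}) :=
  [/\ bounded_op T, positive_op T &
      exists S : {linear H -> H}, [/\ bounded_op S, cancel T S & cancel S T]].

End Operators.

Definition borel (V : ptopologicalType) := g_sigma_algebraType (@open V).

Section ComplexIntegration.
Context d (X : measurableType d) (R : realType).
Variable mu : {measure set X -> \bar R}.

Definition cmeasurable (f : X -> R[i]) :=
  measurable_fun [set: X] (f : X -> borel (R[i])^o).

(* [Re `|m x|] is the modulus of [m x] as an element of [R]. *)
Definition Linfty (m : X -> R[i]) :=
  cmeasurable m /\ ('N[mu]_+oo[(fun x => (complex.Re `|m x|)%:E)] < +oo)%E.

Definition cintegrable (f : X -> R[i]) :=
  mu.-integrable [set: X] (fun x => (complex.Re (f x))%:E) /\
  mu.-integrable [set: X] (fun x => (complex.Im (f x))%:E).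

Definition cintegral (f : X -> R[i]) : R[i] :=
  (\int[mu]_x complex.Re (f x)) +i* (\int[mu]_x complex.Im (f x)).

End ComplexIntegration.

Section GFusion.
Context d (X : measurableType d) (R : realType).
Variables (mu : {measure set X -> \bar R}) (H : hilbertType R).

Definition weakly_measurable (F : X -> closedSubspace H) :=
  forall f : H, measurable_fun [set: X] (fun x => val (orthproj (F x) f) : borel H).

Variable K : X -> hilbertType R.

Definition controlled_gfusion_bessel (T : H -> H) (F : X -> closedSubspace H)
    (L : forall x, F x -> K x) (v : X -> R) (B : R) :=
  let integrand f x : R :=
    v x ^+ 2 * complex.Re (inner (L x (orthproj (F x) (T f)))
                                 (L x (orthproj (F x) (T f)))) in
  (forall f : H, measurable_fun [set: X] (integrand f)) /\
  (forall f : H,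
     (\int[mu]_x (integrand f x)%:E <= (B * complex.Re `|f| ^+ 2)%:E)%E).

Definition multiplier_integrand (m : X -> R[i])
    (T : H -> H) (F : X -> closedSubspace H) (L : forall x, F x -> K x) (v : X -> R)
    (U : H -> H) (G : X -> closedSubspace H) (Ga : forall x, G x -> K x) (w : X -> R)
    (f g : H) (x : X) : R[i] :=
  m x * (v x)%:C * (w x)%:C *
  inner (T (val (orthproj (F x)
           (val (adjoint (L x) (Ga x (orthproj (G x) (U f))))))))
        g.

End GFusion.

(* Main.v *)
Require Import Defs.
From HB Require Import structures.
From mathcomp Require Import all_boot all_order all_algebra.
From mathcomp Require Import complex.
From mathcomp Require Import all_classical all_reals all_analysis.
From mathcomp Require Import measurable_realfun ess_sup_inf.
From mathcomp Require Import ring lra.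

Set Implicit Arguments.
Unset Strict Implicit.
Unset Printing Implicit Defensive.

Import Order.TTheory GRing.Theory Num.Theory.
Import numFieldNormedType.Exports.

Local Open Scope classical_set_scope.
Local Open Scope complex_scope.
Local Open Scope ring_scope.

(** The multiplier is the operator of a bounded sesquilinear form.

    Since [T] is self-adjoint, and since [P_M] composed with the inclusion of
    [M] and the adjoint of [Lambda_x] can both be moved to the other side of
    the inner product, the integrand equals
    [m v w <Gamma_x P_G(x) U f, Lambda_x P_F(x) T g>]
    ([multiplier_integrandE]).  By Cauchy-Schwarz and [a b <= a^2 + b^2], its
    modulus is almost everywhere at most
    [N ((v |Lambda_x P_F(x) T g|)^2 + (w |Gamma_x P_G(x) U f|)^2)], where [N] is
    an essential bound of [m].  The two squares are exactly the integrands of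
    the Bessel conditions, so the integrand is integrable and its integral
    [Phi(f, g)] satisfies
    [|Phi(f, g)| <= C (|f|^2 + |g|^2)].  The sum of squares
    is as good as Hoelder's product of norms here: [Phi] is sesquilinear, so
    rescaling [f] and [g] to unit vectors turns this bound into
    [|Phi(f, g)| <= 2 C |f| |g|], and Riesz' theorem then yields the operator
    ([bounded_sesquilinear_op]).

    Everything on the Hilbert space side rests on the Riesz theorem ([riesz]).
    Applied to a Hilbert space it gives the adjoint ([adjointP]); applied to a
    closed subspace, which is a Hilbert space in its own right, it gives the
    orthogonal projection ([orthprojP]).  The representing vector of [phi] is the
    minimiser of [|f|^2 - 2 Re (phi f)], reached as the limit of the filter of
    almost minimisers. *)

(** * Norms as real numbers *)

(** The norm of a normed module over [R[i]] lives in [R[i]], where order is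
    partial; its real part carries the same information and can be handled by
    the decision procedures for ordered fields. *)
Definition rnorm (R : realType) (V : normedZmodType R[i]) (x : V) : R :=
  complex.Re `|x|.

Section RealNorm.
Context (R : realType).

Lemma rnormE (V : normedZmodType R[i]) (x : V) : `|x| = (rnorm x)%:C.
Proof. by rewrite /rnorm RRe_real// normr_real. Qed.

Lemma rnorm_ge0 (V : normedZmodType R[i]) (x : V) : 0 <= rnorm x.
Proof. by rewrite -ler0c -rnormE. Qed.

Lemma rnorm0 (V : normedZmodType R[i]) : rnorm (0 : V) = 0.
Proof. by rewrite /rnorm normr0. Qed.

Lemma rnorm_eq0 (V : normedZmodType R[i]) (x : V) : (rnorm x == 0) = (x == 0).
Proof. by rewrite -[RHS]normr_eq0 rnormE (inj_eq (@complexI R) _ 0). Qed.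

Lemma rnorm_gt0 (V : normedZmodType R[i]) (x : V) : (0 < rnorm x) = (x != 0).
Proof. by rewrite lt_neqAle rnorm_ge0 andbT eq_sym rnorm_eq0. Qed.

Lemma rnormZ (V : normedModType R[i]) (a : R[i]) (x : V) :
  rnorm (a *: x) = rnorm a * rnorm x.
Proof. by apply: complexI; rewrite rmorphM/= -!rnormE normrZ. Qed.

Lemma rnormM (a b : R[i]) : rnorm (a * b) = rnorm a * rnorm b.
Proof. by apply: complexI; rewrite rmorphM/= -!rnormE normrM. Qed.

Lemma rnorm_real (a : R) : rnorm a%:C = `|a|.
Proof.
by apply: complexI; rewrite -rnormE normc_def/= expr0n addr0 sqrtr_sqr.
Qed.

Lemma rnormD (V : normedZmodType R[i]) (x y : V) :
  rnorm (x + y) <= rnorm x + rnorm y.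
Proof. by rewrite -lecR rmorphD/= -!rnormE ler_normD. Qed.

Lemma rnormN (V : normedZmodType R[i]) (x : V) : rnorm (- x) = rnorm x.
Proof. by rewrite /rnorm normrN. Qed.

Lemma rnormJ (z : R[i]) : rnorm z^* = rnorm z.
Proof. by rewrite /rnorm normcJ. Qed.

Lemma ReD (x y : R[i]) : complex.Re (x + y) = complex.Re x + complex.Re y.
Proof. by case: x y => [? ?] []. Qed.

Lemma rnorm_nat n : rnorm (n%:R : R[i]) = n%:R.
Proof.
by rewrite /rnorm normr_nat; elim: n => // n IH; rewrite -!natr1 ReD IH.
Qed.

Lemma ReN (x : R[i]) : complex.Re (- x) = - complex.Re x.
Proof. by case: x. Qed.

Lemma ReMr (a : R) (z : R[i]) : complex.Re (a%:C * z) = a * complex.Re z.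
Proof. by case: z => x y /=; rewrite mul0r subr0. Qed.

Lemma Re_le_rnorm (z : R[i]) : `|complex.Re z| <= rnorm z.
Proof. by rewrite -lecR -rnormE normc_ge_Re. Qed.

Lemma Im_le_rnorm (z : R[i]) : `|complex.Im z| <= rnorm z.
Proof.
by rewrite /rnorm normc_def/= -sqrtr_sqr ler_wsqrtr// lerDr sqr_ge0.
Qed.

Lemma rnorm_le_ReIm (z : R[i]) :
  rnorm z <= `|complex.Re z| + `|complex.Im z|.
Proof.
rewrite [z in rnorm z]complexE (le_trans (rnormD _ _))// rnormM !rnorm_real.
by rewrite /rnorm normc_def/= expr0n add0r expr1n sqrtr1 mul1r.
Qed.

(** Rotating by the phase [u] turns statements about the real part of a linear
    functional into statements about its modulus. *)
Lemma phaseP (z : R[i]) : exists2 u : R[i], rnorm u = 1 & u * z = (rnorm z)%:C.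
Proof.
have [->|z0] := eqVneq z 0.
  by exists 1; [exact: (rnorm_nat 1) | rewrite mulr0 rnorm0].
have n0 : rnorm z != 0 by rewrite rnorm_eq0.
exists ((rnorm z)%:C / z); last by rewrite divfK.
apply: (mulIf n0); rewrite -rnormM divfK// rnorm_real mul1r ger0_norm//.
exact: rnorm_ge0.
Qed.

(** The minimum of the parabola is nonnegative; a line bounded below is
    constant. *)
Lemma quadratic_discr_le (a b c : R) : 0 <= a ->
  (forall s, 0 <= a * s ^+ 2 + 2 * b * s + c) -> b ^+ 2 <= a * c.
Proof.
rewrite le_eqVlt => /predU1P[<-|a0] pos.
  have [->|b0] := eqVneq b 0; first by rewrite mul0r expr0n.
  have := pos (- (c + 1) / (2 * b)).
  have -> : 0 * (- (c + 1) / (2 * b)) ^+ 2 + 2 * b * (- (c + 1) / (2 * b)) + c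
    = -1 by field.
  by rewrite ler0N1.
have := pos (- b / a).
have -> : a * (- b / a) ^+ 2 + 2 * b * (- b / a) + c = (a * c - b ^+ 2) / a.
  by field; rewrite gt_eqF.
by rewrite pmulr_lge0 ?invr_gt0// subr_ge0.
Qed.

End RealNorm.

(** * Inner products and the Riesz representation theorem *)

Section HilbertSpace.
Context (R : realType).
Implicit Types H K E : hilbertType R.

Lemma inner_conj H (x y : H) : inner x y = (inner y x)^*.
Proof. by rewrite (hermC inner) expr0 mul1r. Qed.

Lemma innerDl H (x y z : H) : inner (x + y) z = inner x z + inner y z.
Proof. exact: linearDl. Qed.
Lemma innerDr H (x y z : H) : inner x (y + z) = inner x y + inner x z.
Proof. exact: linearDr. Qed.
Lemma innerBl H (x y z : H) : inner (x - y) z = inner x z - inner y z.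
Proof. exact: linearBl. Qed.
Lemma innerBr H (x y z : H) : inner x (y - z) = inner x y - inner x z.
Proof. exact: linearBr. Qed.
Lemma innerZl H a (x y : H) : inner (a *: x) y = a * inner x y.
Proof. exact: linearZl_LR. Qed.
Lemma innerZr H a (x y : H) : inner x (a *: y) = a^* * inner x y.
Proof. exact: linearZr_LR. Qed.

Lemma inner_rnorm H (x : H) : inner x x = (rnorm x ^+ 2)%:C.
Proof. by rewrite inner_norm rnormE rmorphXn. Qed.

Lemma rnorm_sqrD H (x y : H) :
  rnorm (x + y) ^+ 2 = rnorm x ^+ 2 + 2 * complex.Re (inner x y) + rnorm y ^+ 2.
Proof.
have E (z : H) : rnorm z ^+ 2 = complex.Re (inner z z) by rewrite inner_rnorm.
rewrite !E innerDl !innerDr !ReD (inner_conj y x).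
case: (inner x y) => a b /=; ring.
Qed.

Lemma inner_inj H (a b : H) : (forall f, inner f a = inner f b) -> a = b.
Proof.
move=> ab; apply/eqP; rewrite -subr_eq0 -normr_eq0 -sqrf_eq0 -inner_norm.
by rewrite innerBr ab subrr.
Qed.

(** The single quadratic argument behind both Cauchy-Schwarz ([phi] is the
    inner product with [y] and [e] is [|y|^2]) and Riesz ([phi] is the defect of
    a minimiser up to [e]): along the complex line through [f], with the phase
    that makes [phi] real, the hypothesis is a nonnegative real parabola. *)
Lemma variational_bound E (phi : {scalar E}) (e : R) :
  (forall f, - e <= rnorm f ^+ 2 + 2 * complex.Re (phi f)) ->
  forall f, rnorm (phi f) ^+ 2 <= rnorm f ^+ 2 * e.
Proof.
move=> He f; apply: quadratic_discr_le; first exact: sqr_ge0.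
move=> s; have [u u1 uphi] := phaseP (phi f).
have := He ((s%:C * u) *: f).
rewrite linearZ/= -(mulrA s%:C) uphi ReMr/= rnormZ rnormM u1 rnorm_real mulr1.
by rewrite exprMn real_normK ?num_real// => ?; lra.
Qed.

Lemma cauchy_schwarz H (x y : H) : rnorm (inner x y) <= rnorm x * rnorm y.
Proof.
have lin : scalar (fun x : H => inner x y).
  by move=> a u v; rewrite innerDl innerZl.
pose phi : {scalar H} := HB.pack (fun x : H => inner x y)
  (GRing.isLinear.Build _ _ _ _ (fun x : H => inner x y) lin).
have pos f : - (rnorm y ^+ 2) <= rnorm f ^+ 2 + 2 * complex.Re (phi f).
  by have := sqr_ge0 (rnorm (f + y)); rewrite rnorm_sqrD /=; lra.
have := variational_bound pos x.
by rewrite -exprMn ler_sqr ?nnegrE ?mulr_ge0 ?rnorm_ge0.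
Qed.

(** The functional [J] is bounded below, and the parallelogram identity makes
    its almost minimisers cluster; they converge to some [h] by completeness.
    The equation [phi f = <f, h>] is the vanishing of the derivative of [J] at
    [h]; it is obtained as the limit of the approximate equations that
    [variational_bound] gives for the almost minimisers. *)
Lemma riesz E (phi : {scalar E}) (C : R) :
  (forall f, `|phi f| <= C%:C * `|f|) -> exists h, forall f, phi f = inner f h.
Proof.
move=> phiC.
have {}phiC f : rnorm (phi f) <= C * rnorm f.
  by have := phiC f; rewrite !rnormE -rmorphM/= lecR.
pose J (f : E) := rnorm f ^+ 2 - 2 * complex.Re (phi f).
have JC f : - C ^+ 2 <= J f.
  have := phiC f; have := Re_le_rnorm (phi f).
  rewrite ler_norml => /andP[_ le1].
  have := sqr_ge0 (rnorm f - C); rewrite /J; lra.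
have infJ : has_inf (range J).
  split; first by exists (J 0), 0.
  by exists (- C ^+ 2) => _ [f _ <-].
pose m := inf (range J).
have Jm f : m <= J f by apply: ge_inf; [case: infJ | exists f].
have JD (a f : E) : J (a + f) =
    J a + rnorm f ^+ 2 + 2 * complex.Re (inner f a - phi f).
  rewrite /J rnorm_sqrD (linearD phi) !ReD ReN (inner_conj a f).
  by case: (inner f a) => p q /=; ring.
(* [f] is half of [b - a], so that [a + f] is the midpoint. *)
have para (a b : E) : rnorm (a - b) ^+ 2 <= 2 * (J a + J b) - 4 * m.
  pose f : E := 2^-1 *: (b - a).
  have ba : b - a = f + f.
    by rewrite -scalerDl -[2^-1]mul1r -splitr scale1r.
  have -> : b = a + (f + f) by rewrite -ba addrC subrK.
  have -> : rnorm (a - (a + (f + f))) = 2 * rnorm f.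
    rewrite opprD addrA subrr add0r rnormN.
    by rewrite -mulr2n -scaler_nat rnormZ rnorm_nat.
  have := Jm (a + f); rewrite !JD rnorm_sqrD (linearD phi) innerDl.
  rewrite !ReD !ReN !ReD inner_rnorm /=; lra.
pose F := filter_from [set e : R | 0 < e] (fun e => [set a | J a < m + e]).
have FF : ProperFilter F.
  apply: filter_from_proper.
    apply: filter_from_filter; first by exists 1; exact: ltr01.
    move=> i j i0 j0; exists (Num.min i j); first by rewrite /= lt_min i0.
    move=> a /= Ja; split;
      by rewrite /= (lt_le_trans Ja)// lerD2l ge_min lexx ?orbT.
  move=> e e0; have [_ [a _ <-] ae] := inf_adherent e0 infJ.
  by exists a.
have Fc : cauchy F.
  apply: cauchy_exP => e e0.
  have er : e = (complex.Re e)%:C by rewrite RRe_real// gtr0_real.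
  set r := complex.Re e in er.
  have r0 : 0 < r by rewrite -ltcR -er.
  have d0 : 0 < r ^+ 2 / 8 by rewrite divr_gt0// exprn_gt0.
  have [_ [a _ <-] ae] := inf_adherent d0 infJ.
  exists a, (r ^+ 2 / 8) => // b /= be.
  rewrite -ball_normE /ball_/= rnormE er ltcR.
  rewrite -ltr_sqr ?nnegrE ?rnorm_ge0 ?ltW// (le_lt_trans (para a b))//.
  by rewrite -/m in ae; lra.
have /cvg_ex[h Fh] : cvg F by exact: cauchy_cvg Fc.
exists h => f; apply/eqP; rewrite -subr_eq0; apply: contraT => nz.
pose r := rnorm (phi f - inner f h).
have r0 : 0 < r by rewrite -ltcR -rnormE normr_gt0.
have n0 := rnorm_ge0 f.
(* [e] is chosen so that the error [2 e |f|] of the approximate equation is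
   smaller than the supposed defect [r]. *)
have [e e0 re] : exists2 e, 0 < e & r = e * (2 * rnorm f + 1).
  by exists (r / (2 * rnorm f + 1)); rewrite ?divr_gt0 ?divfK ?gt_eqF//; lra.
have FJ : F [set a | J a < m + e ^+ 2].
  by exists (e ^+ 2) => //=; exact: exprn_gt0.
have Fb : F (ball h e%:C) by apply: Fh; apply: nbhsx_ballx; rewrite ltcR.
have [a /= [Ja ha]] := filter_ex (filterI FJ Fb).
have {}ha : rnorm (h - a) < e.
  by move: ha; rewrite -ball_normE /ball_/= rnormE ltcR.
have psil : scalar (fun g : E => inner g a - phi g).
  by move=> c x y; rewrite innerDl innerZl linearP/=; ring.
pose psi : {scalar E} := HB.pack (fun g : E => inner g a - phi g)
  (GRing.isLinear.Build _ _ _ _ _ psil).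
have pos g : - (e ^+ 2) <= rnorm g ^+ 2 + 2 * complex.Re (psi g).
  by have := Jm (a + g); rewrite JD /=; lra.
have := variational_bound pos f.
rewrite -exprMn ler_sqr ?nnegrE ?mulr_ge0 ?rnorm_ge0 ?(ltW e0)//= => le1.
have : r <= rnorm f * e + rnorm f * e.
  have := cauchy_schwarz f (h - a).
  rewrite innerBr => cs.
  have -> : r = rnorm (- (inner f a - phi f) - (inner f h - inner f a)).
    by congr rnorm; ring.
  rewrite (le_trans (rnormD _ _))// lerD//.
    by rewrite rnormN.
  by rewrite rnormN (le_trans cs)// ler_wpM2l// ltW.
rewrite re; lra.
Qed.

(** * Adjoints, projections and sesquilinear forms *)

Lemma adjointP H K (A : {linear H -> K}) : bounded_op A ->
  forall f k, inner (A f) k = inner f (adjoint A k).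
Proof.
move=> [C AC] f k; move: f.
apply: (@xgetPex _ 0 [set h | forall f, inner (A f) k = inner f h]).
have lin : scalar (fun f => inner (A f) k).
  by move=> a x y; rewrite linearP innerDl innerZl.
pose phi : {scalar H} := HB.pack (fun f => inner (A f) k)
  (GRing.isLinear.Build _ _ _ _ _ lin).
have [|h hP] := @riesz H phi (C * rnorm k); last by exists h.
move=> f; have := AC f; rewrite !rnormE -!rmorphM/= !lecR => Af.
rewrite (le_trans (cauchy_schwarz _ _))//.
by rewrite mulrAC ler_wpM2r// rnorm_ge0.
Qed.

(** A closed subspace is itself a Hilbert space, so the projection of [f] is the
    Riesz vector of the functional [q |-> <q, f>] on [M]. *)
Lemma orthprojP H (M : closedSubspace H) (f : H) (q : M) :
  inner f (val q) = inner (orthproj M f) q.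
Proof.
suff /(_ q) : forall q : M, inner (f - val (orthproj M f)) (val q) = 0.
  by rewrite innerBl => /eqP; rewrite subr_eq0 => /eqP.
apply: (@xgetPex _ 0 [set p : M | forall q : M, inner (f - val p) (val q) = 0]).
have lin : scalar (fun q : M => inner (val q) f).
  by move=> a x y; rewrite linearP innerDl innerZl.
pose phi : {scalar M} := HB.pack (fun q : M => inner (val q) f)
  (GRing.isLinear.Build _ _ _ _ _ lin).
have [|p hP] := @riesz M phi (rnorm f).
  move=> x; rewrite !rnormE -!rmorphM/= !lecR mulrC.
  exact: cauchy_schwarz.
exists p => x; have /= pE := hP x.
by rewrite innerBl inner_conj pE -inner_conj subrr.
Qed.

Lemma orthproj_linear H (M : closedSubspace H) : linear (@orthproj R H M).
Proof.
move=> a x y; apply: inner_inj => q; rewrite inner_conj [RHS]inner_conj.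
by rewrite innerDl innerZl -!orthprojP innerDl innerZl.
Qed.

(** The hypothesis bounds [b] by a sum of squares, which is what integration of
    the inequality [a b <= a^2 + b^2] provides.  As [b] is homogeneous in each
    variable separately, applying it to the normalised vectors bounds [b f g] by
    the product of the norms. *)
Lemma bounded_sesquilinear_op H (b : H -> H -> R[i]) (C : R) :
  (forall a f f' g, b (a *: f + f') g = a * b f g + b f' g) ->
  (forall a f g g', b f (a *: g + g') = a^* * b f g + b f g') ->
  (forall f g, rnorm (b f g) <= C * (rnorm f ^+ 2 + rnorm g ^+ 2)) ->
  exists2 M : {linear H -> H}, bounded_op M & forall f g, inner (M f) g = b f g.
Proof.
move=> bl br bC.
have b0l g : b 0 g = 0.
  by have := bl (-1) 0 0 g; rewrite scaler0 addr0 mulN1r addNr.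
have b0r f : b f 0 = 0.
  by have := br (-1) f 0 0; rewrite scaler0 addr0 rmorphN1 mulN1r addNr.
have bZl a f g : b (a *: f) g = a * b f g.
  by rewrite -[a *: f]addr0 bl b0l addr0.
have bZr a f g : b f (a *: g) = a^* * b f g.
  by rewrite -[a *: g]addr0 br b0r addr0.
have bC' f g : rnorm (b f g) <= (2 * C) * rnorm f * rnorm g.
  have [->|f0] := eqVneq f 0; first by rewrite b0l !rnorm0 mulr0 mul0r.
  have [->|g0] := eqVneq g 0; first by rewrite b0r !rnorm0 mulr0.
  have unit (h : H) : h != 0 ->
      exists2 h', h = (rnorm h)%:C *: h' & rnorm h' = 1.
    move=> h0; have n0 : rnorm h != 0.
      by rewrite rnorm_eq0.
    exists ((rnorm h)^-1%:C *: h).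
      by rewrite scalerA -rmorphM/= divff// scale1r.
    by rewrite rnormZ rnorm_real ger0_norm ?invr_ge0 ?rnorm_ge0// mulVf.
  have [f' fE f1] := unit f f0; have [g' gE g1] := unit g g0.
  rewrite [in b _ _]fE [in b _ _]gE bZl bZr !rnormM rnormJ !rnorm_real.
  rewrite !ger0_norm ?rnorm_ge0//.
  have := bC f' g'; rewrite f1 g1 expr1n -[1 + 1]/2 => le2.
  rewrite mulrA [_ * C]mulrC -[leRHS]mulrA [leRHS]mulrC.
  by rewrite ler_wpM2l// mulr_ge0// rnorm_ge0.
have ex f : exists h, forall g, inner h g = b f g.
  have lin : scalar (fun g => (b f g)^*).
    by move=> a x y; rewrite br rmorphD rmorphM/= conjCK.
  pose phi : {scalar H} := HB.pack (fun g => (b f g)^*)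
    (GRing.isLinear.Build _ _ _ _ _ lin).
  have [|h hP] := @riesz H phi (2 * C * rnorm f).
    by move=> g; rewrite norm_conjC !rnormE -rmorphM lecR.
  exists h => g; rewrite inner_conj -hP/=.
  by rewrite conjCK.
have [M0 M0P] := choice ex.
have lin : linear M0.
  move=> a x y; apply: inner_inj => g; rewrite inner_conj [RHS]inner_conj.
  by rewrite innerDl innerZl !M0P bl.
pose M : {linear H -> H} := HB.pack M0 (GRing.isLinear.Build _ _ _ _ _ lin).
exists M => //; exists (2 * C) => f; rewrite !rnormE -rmorphM lecR.
(* [|M f|^2 = b f (M f) <= 2 C |f| |M f|] *)
rewrite -[M f]/(M0 f); have := bC' f (M0 f).
rewrite -M0P inner_rnorm rnorm_real ger0_norm ?sqr_ge0//.
have [->|n0] := eqVneq (M0 f) 0.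
  move=> _; rewrite rnorm0.
  have [->|f0] := eqVneq f 0; first by rewrite !rnorm0 mulr0.
  have n0 : 0 < rnorm f by rewrite rnorm_gt0.
  by rewrite -(pmulr_lge0 _ n0) (le_trans _ (bC' f f))// rnorm_ge0.
by rewrite expr2 ler_pM2r// rnorm_gt0.
Qed.

End HilbertSpace.

(** * Integrals of complex functions *)

Section ComplexIntegral.
Context (R : realType) d (X : measurableType d).
Variable mu : {measure set X -> \bar R}.

(** The real and imaginary parts are additive and bounded by the modulus, hence
    continuous. *)
Let open_superlevel (p : R[i] -> R) :
  (forall x y, p (x - y) = p x - p y) -> (forall x, `|p x| <= rnorm x) ->
  forall a, open ([set z | a < p z] : set (R[i])^o).
Proof.
move=> pB ple a; rewrite openE => z /= az.
apply: filterS (nbhsx_ballx (z : (R[i])^o) (p z - a)%:C _); last first.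
  by rewrite ltcR subr_gt0.
move=> y; rewrite -ball_normE /ball_/= [X in X < _]rnormE ltcR => zy.
have : p (z - y) < p z - a.
  by rewrite (le_lt_trans _ zy)// (le_trans (ler_norm _)) ?ple.
by rewrite pB ltrD2l ltrN2.
Qed.

Let measurable_part (p : R[i] -> R) (f : X -> R[i]) :
  (forall a, open ([set z | a < p z] : set (R[i])^o)) ->
  cmeasurable f -> measurable_fun [set: X] (p \o f).
Proof.
move=> po mf.
apply: (measurability _ (RGenOInfty.measurableE R)) => // _ [_ [a ->] <-].
have -> : [set: X] `&` (p \o f) @^-1` `]a, +oo[%classic
        = [set: X] `&` f @^-1` [set z | a < p z].
  by congr (_ `&` _); apply/seteqP; split => x /=; rewrite in_itv/= andbT.
by apply: mf => //; exact: sub_sigma_algebra (po a).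
Qed.

Lemma cmeasurable_Re (f : X -> R[i]) :
  cmeasurable f -> measurable_fun [set: X] (fun x => complex.Re (f x)).
Proof.
apply: measurable_part; apply: open_superlevel => [x y|x].
  by rewrite ReD ReN.
exact: Re_le_rnorm.
Qed.

Lemma cmeasurable_Im (f : X -> R[i]) :
  cmeasurable f -> measurable_fun [set: X] (fun x => complex.Im (f x)).
Proof.
apply: measurable_part; apply: open_superlevel => [x y|x].
  by case: x y => [? ?] [].
exact: Im_le_rnorm.
Qed.

(** If [mu] is the zero measure, the essential norm is 0 whatever [m] is, but
    then every bound holds almost everywhere. *)
Lemma Linfty_ae_bounded (m : X -> R[i]) : Linfty mu m ->
  exists2 N, 0 <= N & {ae mu, forall x, rnorm (m x) <= N}.
Proof.
move=> [_]; rewrite unlock; case: ifPn => [mu0|].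
  set s := ess_sup _ _ => soo.
  have := ess_sup_ge mu (abse \o (fun x => (complex.Re `|m x|)%:E)).
  rewrite -/s; case: s soo => [s| |] // _ le_s.
    exists (Num.max 0 s); first by rewrite le_max lexx.
    apply: filterS le_s => x /=; rewrite lee_fin => mxs.
    by rewrite le_max (le_trans (ler_norm _) mxs) orbT.
  by exists 0 => //; apply: filterS le_s.
rewrite -leNgt => mu0; exists 0 => //; exists [set: X]; split => //.
by apply/eqP; rewrite -measure_le0.
Qed.

Let dominated_Rintegral (f u : X -> R) : measurable_fun [set: X] f ->
  mu.-integrable [set: X] (EFin \o u) -> {ae mu, forall x, `|f x| <= u x} ->
  (forall x, 0 <= u x) ->
  mu.-integrable [set: X] (EFin \o f) /\
  `|\int[mu]_x f x| <= \int[mu]_x u x.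
Proof.
move=> mf iu fu u0.
have mu_ : measurable_fun [set: X] (EFin \o u) by case/integrableP: iu.
have le1 : (\int[mu]_x `|(f x)%:E| <= \int[mu]_x (u x)%:E)%E.
  apply: ae_ge0_le_integral => //.
  - by apply: measurableT_comp => //; exact/measurable_EFinP.
  - by move=> x _; rewrite lee_fin.
  - by apply: filterS fu => x fux _; rewrite /= lee_fin.
have uoo : (\int[mu]_x (u x)%:E < +oo)%E.
  by rewrite ltey_eq integrable_fin_num.
have if_ : mu.-integrable [set: X] (EFin \o f).
  apply/integrableP; split; first exact/measurable_EFinP.
  exact: le_lt_trans le1 uoo.
split => //; rewrite (le_trans (le_normr_Rintegral _ _))//.
apply: fine_le => //; apply: integrable_fin_num => //.
exact: integrable_abse if_.
Qed.

(** Bounding the modulus by the sum of the real and imaginary parts costs the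
    factor 2, which is harmless for boundedness. *)
Lemma dominated_cintegral (h : X -> R[i]) (u : X -> R) : cmeasurable h ->
  mu.-integrable [set: X] (EFin \o u) -> (forall x, 0 <= u x) ->
  {ae mu, forall x, rnorm (h x) <= u x} ->
  cintegrable mu h /\ rnorm (cintegral mu h) <= 2 * \int[mu]_x u x.
Proof.
move=> mh iu u0 hu.
have [|iR leR] := dominated_Rintegral (cmeasurable_Re mh) iu _ u0.
  by apply: filterS hu => x; apply: le_trans; exact: Re_le_rnorm.
have [|iI leI] := dominated_Rintegral (cmeasurable_Im mh) iu _ u0.
  by apply: filterS hu => x; apply: le_trans; exact: Im_le_rnorm.
split; first by split.
by rewrite (le_trans (rnorm_le_ReIm _))//= mulr_natl mulr2n lerD.
Qed.

Lemma cintegralP (a : R[i]) (h k : X -> R[i]) :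
  cintegrable mu h -> cintegrable mu k ->
  cintegral mu (fun x => a * h x + k x) = a * cintegral mu h + cintegral mu k.
Proof.
move=> [hR hI] [kR kI]; case: a => p q.
have iZ (r : R) (f : X -> R) : mu.-integrable [set: X] (EFin \o f) ->
    mu.-integrable [set: X] (EFin \o (fun x => r * f x)).
  by move=> fi; apply: eq_integrable (integrableZl _ r fi) => //.
have iD (f g : X -> R) : mu.-integrable [set: X] (EFin \o f) ->
    mu.-integrable [set: X] (EFin \o g) ->
    mu.-integrable [set: X] (EFin \o (fun x => f x + g x)).
  by move=> fi gi; apply: eq_integrable (integrableD _ fi gi) => //.
have lin (s t : R) (f g l : X -> R) : mu.-integrable [set: X] (EFin \o f) ->
    mu.-integrable [set: X] (EFin \o g) ->
    mu.-integrable [set: X] (EFin \o l) ->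
    \int[mu]_x (s * f x + t * g x + l x)
    = s * (\int[mu]_x f x) + t * (\int[mu]_x g x) + \int[mu]_x l x.
  move=> fi gi ki; rewrite RintegralD//; last by apply: iD; exact: iZ.
  by rewrite RintegralD ?RintegralZl//; exact: iZ.
rewrite /cintegral; apply/eqP; rewrite eq_complex/=.
apply/andP; split; apply/eqP.
  rewrite -[- (q * _)]mulNr -lin//; apply: eq_Rintegral => x _.
  by case: (h x) (k x) => [? ?] [? ?] /=; rewrite mulNr.
rewrite -lin//; apply: eq_Rintegral => x _.
by case: (h x) (k x) => [? ?] [? ?] /=.
Qed.

End ComplexIntegral.

(** * Bessel families and multipliers *)

Section Multiplier.
Context d (X : measurableType d) (R : realType).
Variables (mu : {measure set X -> \bar R}) (H : hilbertType R).
Variable K : X -> hilbertType R.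

Lemma bessel_integral (T : H -> H) (F : X -> closedSubspace H)
    (L : forall x, F x -> K x) (v : X -> R) (B : R) (f : H) :
  controlled_gfusion_bessel mu T L v B ->
  mu.-integrable [set: X]
    (EFin \o (fun x => (v x * rnorm (L x (orthproj (F x) (T f)))) ^+ 2)) /\
  \int[mu]_x (v x * rnorm (L x (orthproj (F x) (T f)))) ^+ 2
  <= B * rnorm f ^+ 2.
Proof.
move=> [mI leI].
set I := fun x => (v x * _) ^+ 2.
have IE : (fun x => v x ^+ 2 * complex.Re (inner (L x (orthproj (F x) (T f)))
    (L x (orthproj (F x) (T f))))) = I.
  by apply/funext => x; rewrite inner_rnorm /I exprMn.
have {}mI : measurable_fun [set: X] I by rewrite -IE; exact: mI.
have {}leI : (\int[mu]_x (I x)%:E <= (B * rnorm f ^+ 2)%:E)%E.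
  by rewrite -IE; exact: leI.
have I0 x : 0 <= I x by exact: sqr_ge0.
have iI : mu.-integrable [set: X] (EFin \o I).
  apply/integrableP; split; first exact/measurable_EFinP.
  under eq_integral => x _ do rewrite /= ger0_norm//.
  by rewrite (le_lt_trans leI)// ltry.
split=> //; rewrite -lee_fin /Rintegral fineK//; exact: integrable_fin_num.
Qed.

(** Everything acting after [Gamma_x P_G(x) U f] is moved to the second
    argument, where [T], the projection and [Lambda_x] reassemble into the
    vector that the Bessel condition on [Lambda] controls. *)
Lemma multiplier_integrandE (m : X -> R[i])
    (T U : {linear H -> H}) (F G : X -> closedSubspace H) (v w : X -> R)
    (L : forall x, {linear F x -> K x}) (Ga : forall x, {linear G x -> K x})
    (f g : H) (x : X) :
  bounded_op T -> adjoint T =1 T -> bounded_op (L x) ->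
  multiplier_integrand m T L v U Ga w f g x
  = m x * (v x)%:C * (w x)%:C *
    inner (Ga x (orthproj (G x) (U f))) (L x (orthproj (F x) (T g))).
Proof.
move=> bT aT bL; rewrite /multiplier_integrand; congr (_ * _).
rewrite (adjointP bT) aT.
rewrite inner_conj orthprojP -inner_conj -orthprojP -subspace_innerE.
by rewrite inner_conj -adjointP// -inner_conj.
Qed.

End Multiplier.

Theorem theorem4p7 (R : realType) (d : measure_display) (X : measurableType d)
    (mu : {measure set X -> \bar R}) (H : hilbertType R) (hH : separable H)
    (T U : {linear H -> H}) (hT : GBpos T) (hU : GBpos U)
    (F G : X -> closedSubspace H)
    (hF : weakly_measurable F) (hG : weakly_measurable G)
    (v w : X -> R) (hv0 : forall x, 0 <= v x) (hw0 : forall x, 0 <= w x)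
    (hv : measurable_fun [set: X] v) (hw : measurable_fun [set: X] w)
    (K : X -> hilbertType R)
    (Lambda : forall x, {linear F x -> K x})
    (Gamma : forall x, {linear G x -> K x})
    (hLambda : forall x, bounded_op (Lambda x))
    (hGamma : forall x, bounded_op (Gamma x))
    (B D : R)
    (bLambda : controlled_gfusion_bessel mu T Lambda v B)
    (bGamma : controlled_gfusion_bessel mu U Gamma w D)
    (m : X -> R[i]) (hm : Linfty mu m)
    (hmeas : forall f g : H,
       cmeasurable (multiplier_integrand m T Lambda v U Gamma w f g)) :
  (forall f g : H,
     cintegrable mu (multiplier_integrand m T Lambda v U Gamma w f g)) /\
  exists M : {linear H -> H},
    [/\ bounded_op M,
        forall f g : H,
          inner (M f) g
          = cintegral mu (multiplier_integrand m T Lambda v U Gamma w f g) &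
        forall M' : H -> H,
          (forall f g : H,
             inner (M' f) g
             = cintegral mu (multiplier_integrand m T Lambda v U Gamma w f g)) ->
          M' =1 M].
Proof.
have [bT [aT _] _] := hT; have [N N0 mN] := Linfty_ae_bounded hm.
pose Phi := multiplier_integrand m T Lambda v U Gamma w.
pose lam g x := v x * rnorm (Lambda x (orthproj (F x) (T g))).
pose gam f x := w x * rnorm (Gamma x (orthproj (G x) (U f))).
have PhiE f g x : Phi f g x = m x * (v x)%:C * (w x)%:C *
    inner (Gamma x (orthproj (G x) (U f))) (Lambda x (orthproj (F x) (T g))).
  exact: multiplier_integrandE.
pose u f g x := N * (lam g x ^+ 2 + gam f x ^+ 2).
have u0 f g x : 0 <= u f g x by rewrite mulr_ge0// addr_ge0// sqr_ge0.
have Phiu f g : {ae mu, forall x, rnorm (Phi f g x) <= u f g x}.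
  apply: filterS mN => x mxN.
  have lam0 : 0 <= lam g x by rewrite mulr_ge0// rnorm_ge0.
  have gam0 : 0 <= gam f x by rewrite mulr_ge0// rnorm_ge0.
  have leM : rnorm (Phi f g x) <= rnorm (m x) * (lam g x * gam f x).
    rewrite PhiE !rnormM !rnorm_real !ger0_norm// -!mulrA.
    rewrite ler_wpM2l ?rnorm_ge0//.
    rewrite /lam /gam ler_wpM2l// [leRHS]mulrCA ler_wpM2l// [leRHS]mulrC.
    exact: cauchy_schwarz.
  rewrite (le_trans leM)// ler_pM ?rnorm_ge0//; first exact: mulr_ge0.
  by have := sqr_ge0 (lam g x - gam f x); have := mulr_ge0 lam0 gam0; lra.
(* [B] and [D] may be negative when [H] is trivial, hence the moduli. *)
have int_u f g : mu.-integrable [set: X] (EFin \o u f g) /\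
    \int[mu]_x u f g x <= N * (`|B| + `|D|) * (rnorm f ^+ 2 + rnorm g ^+ 2).
  have [ilam le_lam] := bessel_integral g bLambda.
  have [igam le_gam] := bessel_integral f bGamma.
  have isum : mu.-integrable [set: X]
      (EFin \o (fun x => lam g x ^+ 2 + gam f x ^+ 2)).
    by apply: eq_integrable (integrableD _ ilam igam).
  split; first by apply: eq_integrable (integrableZl _ N isum).
  rewrite RintegralZl// -mulrA ler_wpM2l// RintegralD//.
  have := sqr_ge0 (rnorm f); have := sqr_ge0 (rnorm g).
  have := ler_norm B; have := ler_norm D.
  have := normr_ge0 B; have := normr_ge0 D.
  rewrite /lam /gam; nra.
have Phi_int f g :=
  dominated_cintegral (hmeas f g) (int_u f g).1 (u0 f g) (Phiu f g).
split; first by move=> f g; have [] := Phi_int f g.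
have [|||M bM ME] := @bounded_sesquilinear_op _ H
  (fun f g => cintegral mu (Phi f g)) (2 * (N * (`|B| + `|D|))).
- move=> a f f' g; rewrite -cintegralP; [|exact: (Phi_int _ _).1..].
  congr cintegral; apply/funext => x.
  by rewrite !PhiE linearP orthproj_linear linearP innerDl innerZl; ring.
- move=> a f g g'; rewrite -cintegralP; [|exact: (Phi_int _ _).1..].
  congr cintegral; apply/funext => x.
  by rewrite !PhiE linearP orthproj_linear linearP innerDr innerZr; ring.
- move=> f g; rewrite (le_trans (Phi_int f g).2)// -mulrA ler_wpM2l//.
  exact: (int_u f g).2.
exists M; split => // M' M'E f; apply: inner_inj => g.
by rewrite inner_conj M'E -ME -inner_conj.
Qed.
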